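(* Let $n \geq 4$ and let $\mathsf{F}(n) := \big(\mathrm{fix}_z(\sigma \tau^{-1})\big)_{\sigma, \tau \in \mathfrak{S}_n}$. Then $\mathsf{F}(n)$ is diagonalizable, and $\mathrm{Sp}\big(\mathsf{F}(n)\big) = \big\{n!z,\ n(n-2)!z,\ 0\big\}$ with multiplicities $$\mathrm{m}_{\mathsf{F}(n)}(n!z) = 1,\qquad \mathrm{m}_{\mathsf{F}(n)}\big(n(n-2)!z\big) = (n-1)^2,\qquad \mathrm{m}_{\mathsf{F}(n)}(0) = n! - (n-1)^2 -1.$$
   Context: $[n]=\{1,\dots,n\}$ and $\mathfrak{S}_n$ is the symmetric group of $[n]$. Let $z$ be an indeterminate over $\mathbb{R}$. For $\sigma\in\mathfrak{S}_n$, $\mathrm{fix}_z\,\sigma := \#\{i\in[n]\mid \sigma(i)=i\}\cdot z\in\mathbb{R}[z]$. $\mathsf{F}(n)$ is an $n!\times n!$ matrix with rows and columns indexed by $\mathfrak{S}_n$ and entries in $\mathbb{R}[z]$, regarded as a matrix over the field of fractions $\mathbb{R}(z)$. $\mathrm{Sp}(\mathsf{M})$ is the set of eigenvalues of a square matrix $\mathsf{M}$ and $\mathrm{m}_{\mathsf{M}}(x)$ is the multiplicity of the eigenvalue $x$. *)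

(* Defs.v *)
From HB Require Import structures.
From mathcomp Require Import all_boot all_order all_algebra all_fingroup.
From mathcomp Require Import reals.

Set Implicit Arguments.
Unset Strict Implicit.
Unset Printing Implicit Defensive.

Import Order.TTheory GRing.Theory Num.Theory.
Local Open Scope ring_scope.

Definition fixz (R : realType) (n : nat) (s : 'S_n) : {poly R} :=
  #|[set i | s i == i]|%:R * 'X.

(* Permutations multiply left to right in perm.v: (u * v) i = v (u i). Hence
   t^-1 * s is the map i |-> s (t^-1 i), that is, s o t^-1 in the usual
   right-to-left convention. *)
Definition fix_mx (R : realType) (n : nat) :
    'M[{fraction {poly R}}]_#|{: 'S_n}| :=
  \matrix_(i, j) tofrac (fixz R ((enum_val j)^-1 * enum_val i)%g).

(* Algebraic multiplicity; zero exactly when x is not an eigenvalue. *)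
Definition eigen_mult (K : fieldType) (m : nat) (M : 'M[K]_m) (x : K) : nat :=
  mup x (char_poly M).

(* Main.v *)
(* Let A be the matrix of the numbers fix (t^-1 s), so that F = z A, and put
   b = n (n-2)!. Counting permutations with two prescribed values gives
   A (A - b) = n (n-2) (n-2)! J, where J is the all-ones matrix, and each row
   of A sums to n!. Hence (F - n! z) F (F - b z) = 0, so F is diagonalizable
   with eigenvalues among n! z, b z, 0. The multiplicities are then determined
   by the traces of F and F^2. *)

Require Import Defs.
From HB Require Import structures.
From mathcomp Require Import all_boot all_order all_algebra all_fingroup.
From mathcomp Require Import reals.
From mathcomp Require Import ring zify.

Set Implicit Arguments.
Unset Strict Implicit.
Unset Printing Implicit Defensive.

Import Order.TTheory GRing.Theory Num.Theory.
Local Open Scope ring_scope.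

(** * Permutations with prescribed values *)

(** Right multiplication by [p^-1] maps these permutations bijectively onto those fixing [S]
    pointwise, that is, onto the permutations of [~: S]. *)
Lemma card_perm_eq_on (T : finType) (S : {set T}) (p : {perm T}) :
  #|[set u : {perm T} | [forall x in S, u x == p x]]| = (#|~: S|)`!.
Proof.
rewrite -card_perm -(card_imset _ (mulIg p^-1%g)).
apply: eq_card => v; apply/imsetP/idP => [[u + ->]|/subsetP v_on].
  rewrite inE => /forall_inP up; apply/subsetP => x; rewrite !inE permM.
  by apply: contra => xS; rewrite (eqP (up _ xS)) permK.
exists (v * p)%g; last by rewrite mulgK.
rewrite inE; apply/forall_inP => x xS; rewrite permM; apply/eqP; congr (p _).
by apply/eqP; apply: contraLR xS => /v_on; rewrite inE.
Qed.

Lemma card_perm1 (T : finType) (i a : T) :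
  #|[set u : {perm T} | u i == a]| = (#|T| - 1)`!.
Proof.
have -> : (#|T| - 1)%N = #|~: [set i]| by rewrite [RHS]cardsCs setCK cards1.
rewrite -(card_perm_eq_on [set i] (tperm i a)).
apply: eq_card => u; rewrite !inE; apply/eqP/forall_inP => [ui x|/(_ i)].
  by rewrite inE => /eqP->; rewrite ui tpermL.
by rewrite inE eqxx tpermL => /(_ isT)/eqP.
Qed.

Lemma card_perm2 (T : finType) (i k a b : T) : i != k -> a != b ->
  #|[set u : {perm T} | (u i == a) && (u k == b)]| = (#|T| - 2)`!.
Proof.
move=> ik ab; set c := tperm i a k.
(* Here [c] is the image of [k] under the first transposition. Since [a] is neither [c] nor [b], the
   second one sends [c] to [b] and leaves the value [a] at [i] untouched. *)
have ac : a != c by rewrite -(tpermL i a) (inj_eq perm_inj).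
pose p := (tperm i a * tperm c b)%g.
have pi : p i = a by rewrite permM tpermL tpermD // eq_sym.
have pk : p k = b by rewrite permM tpermL.
have -> : (#|T| - 2)%N = #|~: [set i; k]|.
  by rewrite [RHS]cardsCs setCK cards2 ik.
rewrite -(card_perm_eq_on [set i; k] p).
apply: eq_card => u; rewrite !inE.
apply/andP/forall_inP => [[/eqP ui /eqP uk] x|up].
  by rewrite !inE => /orP[] /eqP->; rewrite ?ui ?uk ?pi ?pk.
by rewrite -{1}pi -pk !up ?inE ?eqxx ?orbT.
Qed.

(** * Fixed-point counts and their convolution *)

(** The factor of ['X] in [fixz], kept in [nat] so that the counting is done before passing to the
    field. *)
Definition fixn (n : nat) (s : 'S_n) : nat := #|[set i | s i == i]|.

Lemma fixnE n (s : 'S_n) : fixn s = (\sum_i (s i == i))%N.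
Proof. by rewrite /fixn -sum1dep_card big_mkcond. Qed.

Lemma fixn_mulVg n (s t : 'S_n) : fixn (t^-1 * s)%g = (\sum_i (s i == t i))%N.
Proof.
rewrite fixnE (reindex_inj (@perm_inj _ t)) /=.
by apply: eq_bigr => i _; rewrite permM permK.
Qed.

(** Each of the [n] points is fixed by (n - 1)! permutations. At [n = 0] the sum is empty in effect,
    while 0! is 1. *)
Lemma sum_fixn n : (0 < n)%N -> (\sum_(s : 'S_n) fixn s = n`!)%N.
Proof.
case: n => // n _; under eq_bigr do rewrite fixnE.
rewrite exchange_big /= (eq_bigr (fun=> n`!)); last first.
  move=> i _; have -> : n`! = (#|'I_n.+1| - 1)`! by rewrite card_ord subn1.
  rewrite -(card_perm1 i i).
  by rewrite -sum1dep_card [RHS]big_mkcond.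
by rewrite sum_nat_const card_ord factS.
Qed.

(* The convolution square of the fixed-point character: with chi = fix - 1
   irreducible of degree n - 1, this is
   (1 + chi) * (1 + chi) = n! (1 + chi / (n - 1)). *)
Lemma sum_fixn_mul n (s t : 'S_n) : (2 <= n)%N ->
  (\sum_u fixn (u^-1 * s)%g * fixn (t^-1 * u)%g =
   n * (n - 2)`! * fixn (t^-1 * s)%g + n * (n - 2) * (n - 2)`!)%N.
Proof.
move=> n2.
pose w (i k : 'I_n) := (\sum_(u : 'S_n) (u i == s i) * (u k == t k))%N.
have -> : (\sum_u fixn (u^-1 * s)%g * fixn (t^-1 * u)%g = \sum_i \sum_k w i k)%N.
  under eq_bigr do rewrite !fixn_mulVg big_distrl /=.
  rewrite exchange_big; apply: eq_bigr => i _ /=.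
  rewrite exchange_big /=; apply: eq_bigr => u _.
  by rewrite big_distrr; apply: eq_bigr => k _; rewrite /= eq_sym.
have wE i k : w i k = #|[set u : 'S_n | (u i == s i) && (u k == t k)]|.
  rewrite -sum1dep_card big_mkcond /w; apply: eq_bigr => u _.
  by case: eqP; case: eqP.
have w1 i : w i i = ((n - 1)`! * (s i == t i))%N.
  have [st|st] := eqVneq (s i) (t i).
    rewrite wE muln1 -[in RHS](card_ord n) -(card_perm1 i (s i)).
    by apply: eq_card => u; rewrite !inE -st andbb.
  rewrite /w big1 ?muln0 // => u _; case: eqP => //= ->.
  by rewrite (negPf st).
have w2 i k : i != k -> w i k = ((n - 2)`! * (s i != t k))%N.
  move=> ik; have [st|st] := eqVneq (s i) (t k).
    rewrite /w big1 ?muln0 // => u _; case: eqP => //= ui.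
    by rewrite -st -ui; case: eqP => // /perm_inj /eqP; rewrite eq_sym (negPf ik).
  by rewrite wE muln1 -[in RHS](card_ord n) (card_perm2 ik st).
(* The added term is what the formula of [w2] would give at [k = i]. It completes the sum to all
   [k], where only [k = t^-1 (s i)] contributes nothing, and it avoids subtraction in [nat]. *)
have row i : (\sum_k w i k + (n - 2)`! * (s i != t i) =
    (n - 1)`! * (s i == t i) + (n - 2)`! * (n - 1))%N.
  rewrite (bigD1 i) //= w1 (eq_bigr (fun k => ((n - 2)`! * (s i != t k))%N)).
    rewrite -addnA; congr (_ + _)%N; rewrite -big_distrr -mulnDr; congr (_ * _)%N.
    rewrite /= addnC -(bigD1 i (P := predT) (F := fun k => (s i != t k) : nat)) //.
    have -> : (\sum_k (s i != t k) = #|~: [set (t^-1)%g (s i)]|)%N.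
      rewrite -sum1_card [RHS]big_mkcond; apply: eq_bigr => k _.
      by rewrite !inE eq_sym (can2_eq (permK t) (permKV t)); case: eqP.
    by rewrite cardsCs setCK cards1 card_ord.
  by move=> k ki; rewrite w2 // eq_sym.
rewrite fixn_mulVg; move: row; set S := (\sum_i \sum_k w i k)%N => row.
have : (\sum_i (\sum_k w i k + (n - 2)`! * (s i != t i)) =
  \sum_i ((n - 1)`! * (s i == t i) + (n - 2)`! * (n - 1)))%N.
  by apply: eq_bigr => i _.
rewrite !big_split /= -/S -!big_distrr /= sum_nat_const card_ord.
set f := (\sum_i (s i == t i))%N.
have -> : (\sum_i (s i != t i) = n - f)%N.
  apply/eqP; rewrite -(eqn_add2r f) -big_split /=.
  rewrite (eq_bigr (fun=> 1%N)) => [|i _]; last by case: eqP.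
  rewrite sum_nat_const card_ord muln1 subnK //.
  rewrite -[leqRHS]card_ord -sum1_card leq_sum // => i _.
  by case: eqP.
have fn : (f <= n)%N.
  by rewrite -[leqRHS]card_ord -sum1_card leq_sum // => i _; case: eqP.
have : ((n - 2)`! * (n - f) + (n - 2)`! * f = (n - 2)`! * n)%N.
  by rewrite -mulnDr subnK.
move: n2 fn; clearbody f S; clear.
(* Shifting [n] by two removes the truncated subtractions and lets (n - 1)! unfold to (n - 1) (n -
   2)!. *)
case: n => [|[|n]] // _.
rewrite !subSS !subn0 factS => *; lia.
Qed.

(** * Matrices annihilated by a cubic with three distinct roots *)

(** Take determinants in P (X - A) = (X - B) P and cancel det P, a nonzero constant. *)
Lemma char_poly_simmx (K : fieldType) m (P A B : 'M[K]_m) :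
  P \in unitmx -> P *m A = B *m P -> char_poly A = char_poly B.
Proof.
move=> Pu PA; apply: (mulfI (_ : \det (map_mx polyC P) != 0)).
  by rewrite det_map_mx polyC_eq0 -unitfE -unitmxE.
rewrite [RHS]mulrC /char_poly -!det_mulmx /char_poly_mx mulmxBr mulmxBl.
by rewrite -!map_mxM PA scalar_mxC.
Qed.

Lemma natr_inj_pchar0 (K : fieldType) :
  [pchar K] =i pred0 -> injective (fun k => k%:R : K).
Proof.
move=> /pcharf0P ch j k jk; wlog le_jk : j k jk / (j <= k)%N => [hw|].
  by case/orP: (leq_total j k) => /hw; [apply | move/(_ (esym jk))].
apply/eqP; rewrite eqn_leq le_jk /= -subn_eq0 -ch natrB //.
by rewrite subr_eq0 eq_sym; apply/eqP.
Qed.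

(** Intended for a list of eigenvalues, with [f] the identity or the square: the sums are then the
    traces of a matrix and of its square, to which the value 0 contributes nothing. *)
Lemma count_three (K : fieldType) (a b : K) (s : seq K) :
  uniq [:: a; b; 0] -> {subset s <= [:: a; b; 0]} ->
  (count_mem a s + count_mem b s + count_mem 0%R s = size s)%N /\
  forall f : K -> K, f 0 = 0 ->
    \sum_(y <- s) f y = f a *+ count_mem a s + f b *+ count_mem b s.
Proof.
rewrite /= !inE negb_or andbT => /andP[/andP[ab a0] b0].
elim: s => [_|y s IHs sub]; first by split=> // f _; rewrite big_nil addr0.
have [x xs|IH1 IH2] := IHs; first by apply: sub; rewrite inE xs orbT.
have [ba [za zb]] : b != a /\ 0 != a /\ 0 != b.
  by rewrite (eq_sym b) ![0 == _]eq_sym.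
have E := (eqxx, negPf ab, negPf a0, negPf b0, negPf ba, negPf za, negPf zb).
split=> [|f f0]; last rewrite big_cons IH2 // /=;
  move: (sub y (mem_head _ _)); rewrite /= -?IH1 !inE => /or3P[] /eqP->;
  rewrite !E ?f0 ?add0n //=; try lia.
- by rewrite mulrS addrA.
- by rewrite mulrS addrCA.
- by rewrite add0r.
Qed.

(* In characteristic 0 the traces of M and M^2 form an invertible linear system
   in the multiplicities of a and b. *)
Lemma diag_three_eigenvalues (K : fieldType) m (M : 'M[K]_m) (a b : K) (p q : nat) :
  [pchar K] =i pred0 -> (0 < m)%N -> uniq [:: a; b; 0] ->
  (M - a%:M) *m (M *m (M - b%:M)) = 0 ->
  \tr M = a *+ p + b *+ q -> \tr (M *m M) = a ^+ 2 *+ p + b ^+ 2 *+ q ->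
  [/\ diagonalizable M, {subset eigenvalue M <= [:: a; b; 0]},
      mup a (char_poly M) = p, mup b (char_poly M) = q &
      mup 0 (char_poly M) = (m - p - q)%N].
Proof.
case: m M => // m M ch _ uab M0 tr1 tr2.
have dM : diagonalizable M.
  (* The minimal polynomial divides (X - a) (X - b) X, whose roots are distinct. *)
  apply/diagonalizableP; exists [:: a; b; 0] => //; apply: mxminpoly_min.
  rewrite !big_cons big_nil mulr1 subr0 [('X - b%:P) * _]mulrC.
  by rewrite !rmorphM !rmorphB /= horner_mx_X !horner_mx_C.
case: (dM) => P Pu /diagonalizable_forPex[d /(simmxP Pu) PM].
set D := diag_mx d in PM.
pose s := [seq d 0 i | i <- enum 'I_m.+1].
have chM : char_poly M = \prod_(y <- s) ('X - y%:P).
  rewrite (char_poly_simmx Pu PM) char_poly_trig ?diag_mx_is_trig //.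
  rewrite big_map big_enum /=.
  by apply: eq_bigr => i _; rewrite mxE eqxx mulr1n.
have PMc c : P *m (M - c%:M) = (D - c%:M) *m P.
  by rewrite mulmxBr mulmxBl PM scalar_mxC.
(* Conjugating the cubic relation to [D] makes every diagonal entry a root of the cubic. *)
have D0 : (D - a%:M) *m (D *m (D - b%:M)) = 0.
  rewrite -[LHS](mulmxK Pu).
  have -> : (D - a%:M) *m (D *m (D - b%:M)) *m P =
      P *m ((M - a%:M) *m (M *m (M - b%:M))).
    by rewrite -!mulmxA -PMc (mulmxA D) -PM !mulmxA PMc.
  by rewrite M0 mulmx0 mul0mx.
have s_sub : {subset s <= [:: a; b; 0]}.
  move=> _ /mapP[i _ ->]; move/matrixP/(_ i i): D0.
  rewrite -!diag_const_mx -!linearB /= !mulmx_diag !mxE eqxx !mulr1n.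
  move/eqP; rewrite !mulf_eq0 !subr_eq0 !inE.
  by case: eqP => //= _; rewrite orbC.
have [cnt sumE] := count_three uab s_sub.
rewrite size_map size_enum_ord in cnt.
have MV : M = invmx P *m (D *m P) by rewrite -PM mulKmx.
have Etr1 : \tr M = \sum_(y <- s) y.
  rewrite MV mxtrace_mulC -mulmxA mulmxV // mulmx1 mxtrace_diag.
  by rewrite big_map big_enum.
have Etr2 : \tr (M *m M) = \sum_(y <- s) y ^+ 2.
  rewrite {1}MV -mulmxA mxtrace_mulC -(mulmxA D) PM -!mulmxA.
  rewrite mulmxV // mulmx1 mulmx_diag mxtrace_diag.
  by rewrite big_map big_enum; apply: eq_bigr => i _; rewrite mxE expr2.
rewrite tr1 sumE // in Etr1.
rewrite tr2 (sumE (fun y => y ^+ 2)) ?expr0n // in Etr2.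
have eigM : {subset eigenvalue M <= [:: a; b; 0]}.
  move=> x; rewrite [x \in _]eigenvalue_root_char chM root_prod_XsubC.
  exact: s_sub.
move: uab; rewrite /= !inE negb_or andbT => /andP[/andP[ab a0] b0].
have Ea : count_mem a s = p.
  apply: (natr_inj_pchar0 ch); apply/eqP.
  (* Subtracting [b] times the first trace equation from the second eliminates the multiplicity of
     [b]. *)
  have : (a * (a - b)) * ((count_mem a s)%:R - p%:R) = 0.
    move: Etr1 Etr2; rewrite -!(mulr_natl a) -!(mulr_natl b).
    rewrite -!(mulr_natl (a ^+ 2)) -!(mulr_natl (b ^+ 2)) => E1 E2.
    have := congr2 (fun u v => v - b * u) E1 E2; move/eqP; rewrite -subr_eq0.
    by move/eqP => E; rewrite -[RHS]oppr0 -[in RHS]E; ring.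
  by move/eqP; rewrite !mulf_eq0 !subr_eq0 (negPf ab) (negPf a0).
have Eb : count_mem b s = q.
  apply: (natr_inj_pchar0 ch); move: Etr1; rewrite Ea => /addrI.
  by rewrite -!(mulr_natl b) => /(mulIf b0).
split=> //; rewrite chM mu_prod_XsubC //.
by rewrite -cnt Ea Eb -subnDA addKn.
Qed.

(** * The spectrum of the fixed-point matrix *)

Unset Implicit Arguments.

Theorem theorem1p4 (R : realType) (n : nat) (hn : (4 <= n)%N) :
  let F : 'M[{fraction {poly R}}]_#|{: 'S_n}| := fix_mx R n in
  let z : {fraction {poly R}} := tofrac 'X in
  [/\ diagonalizable F,
      eigenvalue F =i [:: (n`!)%:R * z; (n * (n - 2)`!)%:R * z; 0],
      eigen_mult F ((n`!)%:R * z) = 1%N,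
      eigen_mult F ((n * (n - 2)`!)%:R * z) = ((n - 1) ^ 2)%N
    & eigen_mult F 0 = (n`! - (n - 1) ^ 2 - 1)%N].
Proof.
move=> F z; set b := (n * (n - 2)`!)%N.
have n2 : (2 <= n)%N by lia.
have n0 : (0 < n)%N by lia.
(* The nonzero eigenvalues have ratio [n - 1], so the trace identities reduce to polynomial
   identities in [n] and [b]. *)
have n1b : n`! = ((n - 1) * b)%N.
  rewrite /b; case: n n2 {hn n0 F b} => [|[|n]] // _.
  by rewrite !factS !subSS !subn0; lia.
have b0 : (0 < b)%N by rewrite muln_gt0 n0 fact_gt0.
have cardS : #|{: 'S_n}| = n`! by rewrite -[RHS]card_Sn -cardsT.
have K0 : [pchar {fraction {poly R}}] =i pred0.
  apply/pcharf0P => k; rewrite -tofrac1 -tofracMn tofrac_eq0 -polyC1 -polyCMn.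
  by rewrite polyC_eq0 pnatr_eq0.
have z0 : z != 0 by rewrite tofrac_eq0 polyX_eq0.
have zinj j k : (j%:R * z == k%:R * z) = (j == k).
  by rewrite (inj_eq (mulIf z0)) (inj_eq (natr_inj_pchar0 K0)).
have FE i j : F i j = (fixn ((enum_val j)^-1 * enum_val i)%g)%:R * z.
  by rewrite mxE /fixz tofracM -/z -[in RHS]tofrac1 -tofracMn.
have sumS (f : 'S_n -> nat) : (\sum_(i < #|{: 'S_n}|) f (enum_val i) = \sum_s f s)%N.
  by rewrite -[LHS]big_enum_val.
pose c := (n * (n - 2) * (n - 2)`!)%N.
have FF i j : (F *m F) i j = (b * fixn ((enum_val j)^-1 * enum_val i)%g + c)%:R * z ^+ 2.
  rewrite mxE -(sum_fixn_mul _ _ n2) -sumS natr_sum mulr_suml.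
  by apply: eq_bigr => k _; rewrite !FE natrM; ring.
have fix1 : fixn (1 : 'S_n)%g = n.
  rewrite fixnE (eq_bigr (fun=> 1%N)) ?sum_nat_const ?card_ord ?muln1 // => i _.
  by rewrite perm1 eqxx.
have FJ : F *m (F - (b%:R * z)%:M) = const_mx (c%:R * z ^+ 2).
  apply/matrixP => i j; rewrite mulmxBr mul_mx_scalar mxE FF.
  by rewrite (mxE _ _ i j) (mxE _ _ i j) FE mxE natrD natrM; ring.
have facK : n`!%:R = (n%:R - 1) * b%:R :> {fraction {poly R}}.
  by rewrite n1b natrM natrB.
have cK : c%:R = (n%:R - 2) * b%:R :> {fraction {poly R}}.
  by rewrite /c mulnAC mulnC natrM natrB.
have sqrK : ((n - 1) ^ 2)%:R = (n%:R - 1) ^+ 2 :> {fraction {poly R}}.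
  by rewrite natrX natrB.
have b_lt : (b < n`!)%N by rewrite n1b ltn_Pmull //; lia.
have uniq_ev : uniq [:: n`!%:R * z; b%:R * z; 0].
  have z0E : 0 = 0%:R * z by rewrite mul0r.
  rewrite /= !inE negb_or andbT z0E !zinj.
  by rewrite -!lt0n (gtn_eqF b_lt) fact_gt0 b0.
have [] := @diag_three_eigenvalues _ _ F _ _ 1 ((n - 1) ^ 2) K0 _ uniq_ev.
- by rewrite cardS fact_gt0.
(* Every row of [F] sums to n! z, so [F] minus this scalar kills the constant matrix of [FJ]. *)
- rewrite FJ; apply/matrixP => i j; rewrite mulmxBl mul_scalar_mx !mxE.
  under eq_bigr do rewrite FE mxE.
  rewrite -!mulr_suml -natr_sum.
  rewrite (sumS (fun s => fixn (s^-1 * enum_val i)%g)).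
  have -> : (\sum_s fixn (s^-1 * enum_val i)%g = n`!)%N.
    rewrite -(sum_fixn n0) (reindex_inj invg_inj) (reindex_inj (mulIg (enum_val i)^-1%g)).
    by apply: eq_bigr => s _; rewrite invgK mulgKV.
  by rewrite subrr.
- rewrite /mxtrace; under eq_bigr do rewrite FE mulVg fix1.
  rewrite sumr_const card_ord cardS mulr1n -[_ *+ n`!]mulr_natr
    -[_ *+ (n - 1) ^ 2]mulr_natr facK sqrK.
  by ring.
(* Both sides equal 2 (n! z)^2: the two nonzero eigenvalues contribute equally, since (n - 1) b =
   n!. *)
- rewrite /mxtrace; under eq_bigr do rewrite FF mulVg fix1.
  rewrite sumr_const card_ord cardS mulr1n -[_ *+ n`!]mulr_natr
    -[_ *+ (n - 1) ^ 2]mulr_natr sqrK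
    natrD natrM cK facK.
  by ring.
move=> dF sub ma mb m0; split=> //; last first.
  by rewrite /eigen_mult m0 cardS subnAC.
move=> x; apply/idP/idP => [/sub //|].
(* Each listed value is an eigenvalue because its multiplicity is positive. *)
have root_mup y : (0 < mup y (char_poly F))%N -> y \in eigenvalue F.
  rewrite -XsubC_dvd ?monic_neq0 ?char_poly_monic // dvdp_XsubCl.
  by rewrite -eigenvalue_root_char.
rewrite !inE => /or3P[] /eqP->; apply: root_mup; rewrite ?ma ?mb ?m0 //.
  by rewrite expn_gt0; lia.
(* With b at least n, the multiplicity of 0 is at least (n - 1) n - (n - 1)^2 - 1 = n - 2, which is
   positive. *)
have b_ge : (n <= b)%N by rewrite leq_pmulr ?fact_gt0.
rewrite cardS n1b; nia.
Qed.
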